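(* Let $p\ge1$ be an integer, $K\in[1,\infty)$, and let $F$ be a $K$-quasiregular polyharmonic mapping in the unit disk $\mathbb{D}$ of the form $$F(z)=\sum_{n=1}^{p}|z|^{2(n-1)}\big(h_n(z)+\overline{g_n(z)}\big)=\sum_{n=1}^{p}|z|^{2(n-1)}\sum_{j=1}^{\infty}\big(a_{n,j}z^{j}+\overline{b_{n,j}}\,\overline{z}^{j}\big),$$ with $l_F(1)<\infty$. Suppose that for all $j\ge 1$ and $n_1,n_2\in\{1,\dots,p\}$, $$\left|\arg\left\{\frac{a_{n_1,j}}{a_{n_2,j}}\right\}\right|=0\quad\text{whenever } a_{n_1,j},a_{n_2,j}\neq 0,\qquad \left|\arg\left\{\frac{b_{n_1,j}}{b_{n_2,j}}\right\}\right|=0\quad\text{whenever } b_{n_1,j},b_{n_2,j}\ne 0.$$ Then for all $n\in\{1,\dots,p\}$ and $j\ge1$, $$|a_{n,j}|+|b_{n,j}|\le\frac{K\,l_F(1)}{2\pi(n+j-1)}.$$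
   Context: $\mathbb{D}=\{z\in\mathbb{C}:|z|<1\}$. A complex-valued mapping $F$ is polyharmonic ($p$-harmonic) in a domain if $\Delta^pF=0$ there, where $\Delta=4\,\partial^2/\partial z\partial\overline z$. In the displayed form, $h_n(z)=\sum_{j\ge1}a_{n,j}z^j$ and $g_n(z)=\sum_{j\ge1}b_{n,j}z^j$ are analytic in $\mathbb{D}$ with complex coefficients. Put $\lambda_F(z)=\big||F_z(z)|-|F_{\overline z}(z)|\big|$ and $\Lambda_F(z)=|F_z(z)|+|F_{\overline z}(z)|$. $F$ is $K$-quasiregular, $K\in[1,\infty)$, if $\Lambda_F(z)\le K\lambda_F(z)$ for all $z\in\mathbb{D}$. For $r\in[0,1)$, the length of the curve $\theta\mapsto F(re^{i\theta})$, $\theta\in[0,2\pi]$, counting multiplicity, is $$l_F(r)=r\int_0^{2\pi}\big|F_z(re^{i\theta})-e^{-2i\theta}F_{\overline z}(re^{i\theta})\big|\,d\theta,$$ and $l_F(1)=\sup_{0<r<1}l_F(r)$. $\arg$ denotes the principal argument in $(-\pi,\pi]$. *)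

(* Defs.v *)
From Stdlib Require Import Reals.
From Coquelicot Require Import Coquelicot.
Open Scope R_scope.

Definition unit_disk (z : C) : Prop := Cmod z < 1.

(** Real partial derivatives of a complex-valued function of [z = x + i y],
    taken componentwise.  [Derive] is total, so [dx] and [dy] carry their usual
    meaning only at points where the partial derivatives exist. *)

Definition dx (F : C -> C) (z : C) : C :=
  (Derive (fun t : R => Re (F (t, Im z))) (Re z),
   Derive (fun t : R => Im (F (t, Im z))) (Re z)).

Definition dy (F : C -> C) (z : C) : C :=
  (Derive (fun t : R => Re (F (Re z, t))) (Im z),
   Derive (fun t : R => Im (F (Re z, t))) (Im z)).

Definition Dz (F : C -> C) (z : C) : C := ((dx F z - Ci * dy F z) / 2)%C.

Definition Dzbar (F : C -> C) (z : C) : C := ((dx F z + Ci * dy F z) / 2)%C.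

Definition laplacian (F : C -> C) (z : C) : C := (4 * Dz (Dzbar F) z)%C.

Definition has_partials (F : C -> C) (z : C) : Prop :=
  ex_derive (V := C_R_NormedModule) (fun t : R => F (t, Im z)) (Re z) /\
  ex_derive (V := C_R_NormedModule) (fun t : R => F (Re z, t)) (Im z).

(** [F] is of class [C^k] on [U] in the real sense; meant for open [U]. *)
Fixpoint smooth_on (k : nat) (U : C -> Prop) (F : C -> C) : Prop :=
  match k with
  | O => forall z : C, U z -> continuous F z
  | S k' => (forall z : C, U z -> has_partials F z) /\
            smooth_on k' U (dx F) /\ smooth_on k' U (dy F)
  end.

(** The [C^(2p)] clause makes the iterated total derivatives in
    [laplacian] genuine ones. *)
Definition polyharmonic (p : nat) (U : C -> Prop) (F : C -> C) : Prop :=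
  smooth_on (2 * p) U F /\
  forall z : C, U z -> Nat.iter p laplacian F z = 0%C.

Definition lambda_min (F : C -> C) (z : C) : R :=
  Rabs (Cmod (Dz F z) - Cmod (Dzbar F z)).

Definition lambda_max (F : C -> C) (z : C) : R :=
  Cmod (Dz F z) + Cmod (Dzbar F z).

Definition quasiregular (K : R) (F : C -> C) : Prop :=
  forall z : C, unit_disk z -> lambda_max F z <= K * lambda_min F z.

Definition cis (t : R) : C := (cos t, sin t).

Definition length_at (F : C -> C) (r : R) : R :=
  r * RInt (fun t : R =>
        Cmod (Dz F (r * cis t) - cis (- 2 * t) * Dzbar F (r * cis t))%C)
      0 (2 * PI).

(** [l_F(1)], the supremum over [0 < r < 1], possibly [p_infty]. *)
Definition length_one (F : C -> C) : Rbar :=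
  Lub_Rbar (fun l : R => exists r : R, 0 < r < 1 /\ l = length_at F r).

(** Principal argument in [(-PI, PI]] of a nonzero complex number. *)
Definition Carg (z : C) : R :=
  if Rle_dec 0 (Im z) then acos (Re z / Cmod z) else - acos (Re z / Cmod z).

(* Main.v *)
Require Import Defs.
From Stdlib Require Import Reals Arith Lra Lia Classical.
From Coquelicot Require Import Coquelicot.
Open Scope R_scope.

(** On the circle of radius [r] the mapping [F] has the Fourier expansion
    with coefficients [sum_n a n j r^(2(n-1)+j)] at frequency [j].  In polar
    coordinates [2 z F_z = (r d/dr - i d/dt) F], so the coefficient of
    [z F_z] at frequency [j] is
      [sum_n (n-1+j) a n j r^(2(n-1)+j)].
    Because the [a n j], [n = 1, ..., p], have a common argument, a rotation
    makes all these terms nonnegative: nothing cancels, and each of them is at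
    most the mean of [r |F_z|] over the circle.

    The conjugate mapping exchanges the roles of [a] and [b] and turns [F_z]
    into the conjugate of [F_zbar], which gives the same bound for [b] with
    [|F_zbar|].  Adding the two, the mean of [r (|F_z| + |F_zbar|)] appears on
    the right.  Quasiregularity replaces the sum by [K] times the absolute
    difference [| |F_z| - |F_zbar| |], which the triangle inequality bounds by
    the integrand of the length.  Hence
      [2 pi (n+j-1) (|a n j| + |b n j|) r^(2(n-1)+j) <= K l_F(r) <= K l_F(1)],
    and [r -> 1] finishes the proof.

    The coefficients of [F] come from termwise integration of the uniformly
    convergent series ([fourier_polyharmonic]).  Those of [z F_z] follow
    without differentiating the series: the radial part is differentiation
    under the integral sign ([radial_integral]), the angular part integration
    by parts over a period ([angular_integral]).  Both only use that [F] is of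
    class C^1.  To stay with real integrals, everything is phrased for
    [Re (exp (-i (j t + ga)) F)], where the phase [ga] is the common argument
    of the coefficients. *)

(** * Polar coordinates *)

(** The generic operations of the algebraic hierarchy, taken at the reals, hide
    from [ring], [field] and [lra]; this exposes the ones underneath. *)
Ltac as_real :=
  repeat match goal with
    | |- context [@scal ?K ?V ?x ?y] => change (@scal K V x y) with (Rmult x y)
    | |- context [@mult ?K ?x ?y] => change (@mult K x y) with (Rmult x y)
    | |- context [@plus ?G ?x ?y] => change (@plus G x y) with (Rplus x y)
    end;
  match goal with |- @eq _ ?x ?y => change (@eq R x y) end.

Lemma cis_add (s t : R) : cis (s + t) = (cis s * cis t)%C.
Proof.
  unfold cis, Cmult; simpl. rewrite cos_plus, sin_plus.
  apply injective_projections; simpl; ring.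
Qed.

Lemma Cconj_cis (t : R) : Cconj (cis t) = cis (- t).
Proof. unfold cis, Cconj; simpl. now rewrite cos_neg, sin_neg. Qed.

Lemma Cconj_RtoC (x : R) : Cconj x = x.
Proof. unfold Cconj, RtoC; simpl. now rewrite Ropp_0. Qed.

Lemma Cmod_cis (t : R) : Cmod (cis t) = 1.
Proof.
  unfold Cmod, cis; simpl.
  replace (cos t * (cos t * 1) + sin t * (sin t * 1)) with 1.
  - apply sqrt_1.
  - pose proof (sin2_cos2 t) as H. unfold Rsqr in H. lra.
Qed.

Lemma cis_pow (t : R) (m : nat) : (cis t ^ m)%C = cis (INR m * t).
Proof.
  induction m as [|m IH].
  - simpl. rewrite Rmult_0_l. unfold cis. now rewrite cos_0, sin_0.
  - rewrite Cpow_S, IH, <- cis_add, S_INR. f_equal. ring.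
Qed.

Lemma polar_point (r t : R) : (r * cis t)%C = (r * cos t, r * sin t).
Proof. unfold cis, Cmult, RtoC; simpl. apply injective_projections; simpl; ring. Qed.

Lemma Cmod_polar (r t : R) : 0 <= r -> Cmod (r * cis t) = r.
Proof. intros Hr. now rewrite Cmod_mult, Cmod_cis, Cmod_R, Rabs_pos_eq, Rmult_1_r. Qed.

Lemma polar_in_disk (r t : R) : 0 < r < 1 -> unit_disk (r * cis t).
Proof. intros Hr. unfold unit_disk. rewrite Cmod_polar; lra. Qed.

Lemma Carg_polar (z : C) : z <> 0%C -> z = (Cmod z * cis (Carg z))%C.
Proof.
  intros Hz. assert (Hm : 0 < Cmod z) by now apply Cmod_gt_0.
  assert (Hq : -1 <= Re z / Cmod z <= 1).
  { pose proof (re_le_Cmod z) as Hre. apply Rabs_le_between in Hre.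
    split; apply Rmult_le_reg_r with (Cmod z); try easy; field_simplify; lra. }
  assert (Hc : Cmod z * (Re z / Cmod z) = Re z) by (field; lra).
  assert (Hs : Cmod z * sin (acos (Re z / Cmod z)) = Rabs (Im z)).
  { rewrite sin_acos by easy.
    rewrite <- (sqrt_Rsqr (Cmod z)) at 1 by lra.
    rewrite <- sqrt_mult_alt by apply Rle_0_sqr.
    rewrite <- sqrt_Rsqr_abs. f_equal.
    assert (H2 : Rsqr (Cmod z) = Re z * Re z + Im z * Im z).
    { unfold Cmod. rewrite Rsqr_sqrt by nra. unfold Re, Im; simpl; ring. }
    rewrite Rmult_minus_distr_l, Rmult_1_r, <- Rsqr_mult, Hc, H2.
    unfold Rsqr. ring. }
  rewrite polar_point. unfold Carg. destruct (Rle_dec 0 (Im z)) as [Hi|Hi].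
  - rewrite cos_acos, Hs, Hc, Rabs_pos_eq by easy. now destruct z.
  - rewrite cos_neg, sin_neg, cos_acos by easy.
    rewrite Ropp_mult_distr_r_reverse, Hs, Hc, Rabs_left, Ropp_involutive by lra.
    now destruct z.
Qed.

Lemma polar_form (z : C) : exists t : R, z = (Cmod z * cis t)%C.
Proof.
  destruct (Ceq_dec z 0) as [->|Hz].
  - exists 0. rewrite Cmod_0. ring.
  - exists (Carg z). now apply Carg_polar.
Qed.

(** * Fourier coefficients on circles *)

(** Weierstrass M-test: the domination makes the partial sums converge
    uniformly, and uniform limits commute with integration over a segment. *)
Lemma is_RInt_series (f : nat -> R -> R) (g : R -> R) (M I : nat -> R) (a b l : R)
  (hM : forall (k : nat) (t : R), Rabs (f k t) <= M k) (hs : ex_series M)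
  (hI : forall k : nat, is_RInt (f k) a b (I k))
  (hg : forall t : R, is_series (fun k : nat => f k t) (g t))
  (hl : is_series I l) : is_RInt g a b l.
Proof.
  destruct hs as [S hS].
  assert (tail : forall (t : R) (N : nat),
    Rabs (g t - sum_n (fun k => f k t) N) <= S - sum_n M N).
  { intros t N.
    (* The tail bound is the limit in [m] of the same bound for finite blocks. *)
    assert (L1 : is_lim_seq (fun m => Rabs (sum_n (fun k => f k t) (N + m) - sum_n (fun k => f k t) N))
                   (Rabs (g t - sum_n (fun k => f k t) N))).
    { apply (is_lim_seq_abs _ (Finite (g t - sum_n (fun k => f k t) N))).
      apply is_lim_seq_minus'; [|apply is_lim_seq_const].
      apply is_lim_seq_ext with (fun m => sum_n (fun k => f k t) (m + N)).
      - intros m; now rewrite Nat.add_comm.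
      - apply is_lim_seq_incr_n. exact (hg t). }
    assert (L2 : is_lim_seq (fun m => sum_n M (N + m) - sum_n M N) (S - sum_n M N)).
    { apply is_lim_seq_minus'; [|apply is_lim_seq_const].
      apply is_lim_seq_ext with (fun m => sum_n M (m + N)).
      - intros m; now rewrite Nat.add_comm.
      - apply is_lim_seq_incr_n. exact hS. }
    refine (is_lim_seq_le _ _ (Finite _) (Finite _) _ L1 L2).
    induction n as [|m IH].
    - rewrite Nat.add_0_r. rewrite !Rminus_diag, Rabs_R0. lra.
    - rewrite Nat.add_succ_r, !sum_Sn. unfold plus; simpl.
      match goal with |- Rabs (?x + ?y - ?z) <= _ =>
        replace (x + y - z) with ((x - z) + y) by ring end.
      eapply Rle_trans; [apply Rabs_triang|].
      specialize (hM (Datatypes.S (N + m)) t). lra. }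
  destruct (filterlim_RInt (V := R_CompleteNormedModule)
    (fun N t => sum_n (fun k => f k t) N) a b eventually _ g (fun N => sum_n I N))
    as [If [H1 H2]].
  - intros N. induction N as [|N IH].
    + apply is_RInt_ext with (f 0%nat); [intros; now rewrite sum_O|].
      rewrite sum_O. apply hI.
    + apply is_RInt_ext with (fun t => plus (sum_n (fun k => f k t) N) (f (Datatypes.S N) t)).
      * intros; now rewrite sum_Sn.
      * rewrite sum_Sn. apply (is_RInt_plus (V := R_NormedModule)); [exact IH|apply hI].
  - apply filterlim_locally. intros eps.
    pose proof (proj1 (filterlim_locally (sum_n M) S) hS eps) as hS'.
    eapply filter_imp; [|exact hS']. intros N HN t.
    unfold ball in HN |- *; simpl in HN |- *; unfold AbsRing_ball, abs, minus, plus, opp in HN |- *; simpl in HN |- *.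
    specialize (tail t N).
    apply Rabs_lt_between in HN.
    rewrite Rabs_minus_sym in tail. unfold Rminus in tail. lra.
  - replace l with If; [exact H2|].
    eapply (filterlim_locally_unique (F := eventually) (fun N => sum_n I N)); [exact H1|exact hl].
Qed.

Lemma is_series_real_linear (s : nat -> C) (l : C) (al be : R) :
  is_series (V := C_NormedModule) s l ->
  is_series (fun k => al * Re (s k) + be * Im (s k)) (al * Re l + be * Im l).
Proof.
  intros H.
  apply filterlim_ext with (fun N => al * Re (sum_n (G := C_AbelianMonoid) s N)
     + be * Im (sum_n (G := C_AbelianMonoid) s N)).
  - intros N; induction N as [|N IH].
    + now rewrite !sum_O.
    + rewrite !sum_Sn, <- IH. unfold plus, Re, Im; simpl. ring.
  - refine (filterlim_comp _ _ _ (sum_n (G := C_AbelianMonoid) s)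
      (fun z : C => al * Re z + be * Im z) _ (locally (T := C_UniformSpace) l) _ H _).
    change (continuous (T := C_UniformSpace) (U := R_UniformSpace) (fun z : C_UniformSpace => al * fst z + be * snd z) l).
    destruct l as [x y].
    apply (continuous_plus (U := C_UniformSpace) (V := R_NormedModule)).
    + apply (continuous_scal_r (U := C_UniformSpace) (V := R_NormedModule) al). apply continuous_fst.
    + apply (continuous_scal_r (U := C_UniformSpace) (V := R_NormedModule) be). apply continuous_snd.
Qed.

(** Convergence at a larger radius [q] bounds the terms there, so [q] is at most
    the radius of convergence of the real series of the moduli, which therefore
    converges at [r]. *)
Lemma ex_series_inside (c : nat -> C) (h : C -> C) (r : R) (hr : 0 < r < 1)
  (hh : forall z : C, unit_disk z ->
     is_series (V := C_NormedModule) (fun k : nat => (c (S k) * z ^ (S k))%C) (h z)) :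
  ex_series (fun k : nat => Cmod (c (S k)) * r ^ (S k)).
Proof.
  set (q := (1 + r) / 2). assert (hq : r < q < 1) by (unfold q; lra).
  assert (Hq : unit_disk (RtoC q)).
  { unfold unit_disk. rewrite Cmod_R, Rabs_pos_eq; lra. }
  pose proof (hh _ Hq) as Hs.
  assert (B : exists B : R, forall k : nat, Rabs (Cmod (c (S k)) * q ^ k) <= B).
  { assert (bd : forall al be : R, exists B : R, forall k : nat,
      Rabs (al * Re (c (S k) * q ^ S k)%C + be * Im (c (S k) * q ^ S k)%C) <= B).
    { intros al be. pose proof (is_series_real_linear _ _ al be Hs) as H.
      assert (H0 : ex_series (fun k : nat => al * Re (c (S k) * q ^ S k)%C
         + be * Im (c (S k) * q ^ S k)%C)) by (eexists; exact H).
      apply ex_series_lim_0 in H0.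
      destruct (filterlim_bounded (K := R_AbsRing) (V := R_NormedModule) _ (ex_intro _ 0 H0))
        as [B HB].
      exists B. exact HB. }
    destruct (bd 1 0) as [B1 H1], (bd 0 1) as [B2 H2].
    exists (sqrt 2 * Rmax B1 B2 / q). intros k. specialize (H1 k). specialize (H2 k).
    rewrite Rabs_pos_eq.
    2:{ apply Rmult_le_pos; [apply Cmod_ge_0|apply pow_le; lra]. }
    apply Rmult_le_reg_r with q; [lra|].
    replace (sqrt 2 * Rmax B1 B2 / q * q) with (sqrt 2 * Rmax B1 B2) by (field; lra).
    replace (Cmod (c (S k)) * q ^ k * q) with (Cmod (c (S k) * q ^ S k)).
    2:{ rewrite Cmod_mult, Cmod_pow, Cmod_R, Rabs_pos_eq by lra. simpl; ring. }
    set (w := (c (S k) * q ^ S k)%C) in *.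
    rewrite Rmult_1_l, Rmult_0_l, Rplus_0_r in H1.
    rewrite Rmult_1_l, Rmult_0_l, Rplus_0_l in H2.
    eapply Rle_trans; [apply Cmod_2Rmax|].
    apply Rmult_le_compat_l; [apply sqrt_pos|].
    apply Rmax_lub; [eapply Rle_trans, Rmax_l|eapply Rle_trans, Rmax_r]; assumption. }
  assert (Hrad : Rbar_le (Finite q) (CV_radius (fun k => Cmod (c (S k))))).
  { apply (proj1 (CV_radius_bounded (fun k => Cmod (c (S k))))). exact B. }
  assert (Hin : ex_series (fun k => Rabs (Cmod (c (S k)) * r ^ k))).
  { apply CV_disk_inside. eapply Rbar_lt_le_trans; [|exact Hrad].
    simpl. rewrite Rabs_pos_eq; lra. }
  apply ex_series_ext with (fun k => scal r (Rabs (Cmod (c (S k)) * r ^ k))).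
  - intros k. as_real.
    rewrite Rabs_pos_eq; [simpl; ring|].
    apply Rmult_le_pos; [apply Cmod_ge_0|apply pow_le; lra].
  - apply (ex_series_scal (V := R_NormedModule) r). exact Hin.
Qed.

Lemma is_RInt_cos_period (k j : nat) (th : R) : k <> j ->
  is_RInt (fun t => cos ((INR k - INR j) * t + th)) 0 (2 * PI) 0.
Proof.
  intros Hkj.
  assert (Hm : INR k - INR j <> 0).
  { intros E. apply Hkj, INR_eq. lra. }
  replace 0 with (minus (sin ((INR k - INR j) * (2 * PI) + th) / (INR k - INR j))
                        (sin ((INR k - INR j) * 0 + th) / (INR k - INR j))) at 2.
  - apply (is_RInt_derive (V := R_CompleteNormedModule)
      (fun t => sin ((INR k - INR j) * t + th) / (INR k - INR j))).
    + intros t _. auto_derive; [easy|]. field; easy.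
    + intros t _. apply (ex_derive_continuous (K := R_AbsRing) (V := R_NormedModule)).
      auto_derive; easy.
  - rewrite Rmult_0_r, Rplus_0_l.
    replace (sin ((INR k - INR j) * (2 * PI) + th)) with (sin th).
    + unfold minus, plus, opp; simpl. ring.
    + rewrite <- (sin_period ((INR k - INR j) * (2 * PI) + th) j).
      rewrite <- (sin_period th k). f_equal. ring.
Qed.

Lemma monomial_polar (c : C) (r t th : R) (m : nat) : c = (Cmod c * cis th)%C ->
  (c * (r * cis t) ^ m)%C = (RtoC (Cmod c * r ^ m) * cis (INR m * t + th))%C.
Proof.
  intros ->. rewrite Cpow_mult_l, cis_pow, cis_add, Cmod_mult, Cmod_cis, Cmod_R.
  rewrite Rabs_pos_eq by apply Cmod_ge_0.
  rewrite Rmult_1_r, RtoC_mult, RtoC_pow. ring.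
Qed.

Lemma Re_cis_scal (x ph s : R) : Re (cis ph * (RtoC s * cis x))%C = s * cos (x + ph).
Proof. unfold cis, RtoC, Cmult, Re; simpl. rewrite cos_plus. ring. Qed.

Lemma is_series_Re_mult (s : nat -> C) (l u : C) :
  is_series (V := C_NormedModule) s l -> is_series (fun k => Re (u * s k)%C) (Re (u * l)%C).
Proof.
  intros H. pose proof (is_series_real_linear _ _ (Re u) (- Im u) H) as H1.
  replace (Re (u * l)%C) with (Re u * Re l + - Im u * Im l)
    by (unfold Re, Im, Cmult; simpl; ring).
  eapply is_series_ext; [|exact H1]. intros k; unfold Re, Im, Cmult; simpl; ring.
Qed.

Lemma is_series_Re_mult_conj (s : nat -> C) (l u : C) :
  is_series (V := C_NormedModule) s l ->
  is_series (fun k => Re (u * Cconj (s k))%C) (Re (u * Cconj l)%C).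
Proof.
  intros H. pose proof (is_series_real_linear _ _ (Re u) (Im u) H) as H1.
  replace (Re (u * Cconj l)%C) with (Re u * Re l + Im u * Im l)
    by (unfold Re, Im, Cmult; simpl; ring).
  eapply is_series_ext; [|exact H1]. intros k; unfold Re, Im, Cmult; simpl; ring.
Qed.

Lemma Rabs_scal_cos (s x : R) : 0 <= s -> Rabs (s * cos x) <= s.
Proof.
  intros Hs. rewrite Rabs_mult, (Rabs_pos_eq s) by easy.
  assert (Rabs (cos x) <= 1) by (apply Rabs_le, COS_bound). nra.
Qed.

Lemma is_series_single (I : nat -> R) (j : nat) :
  (forall k, k <> j -> I k = 0) -> is_series I (I j).
Proof.
  intros H.
  assert (E : forall N, sum_n I N = if le_dec j N then I j else 0).
  { induction N as [|N IH].
    - rewrite sum_O. destruct (le_dec j 0).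
      + now replace j with 0%nat by lia.
      + apply H; lia.
    - rewrite sum_Sn, IH. unfold plus; simpl.
      destruct (le_dec j N), (le_dec j (S N)); try lia.
      + rewrite (H (S N)) by lia. ring.
      + replace j with (S N) by lia. ring.
      + rewrite (H (S N)) by lia. ring. }
  apply filterlim_ext_loc with (fun _ => I j).
  - exists j. intros N HN. rewrite E. destruct (le_dec j N); [easy|lia].
  - apply filterlim_const.
Qed.

(** The integral of [exp (-i (j t + ga)) h] picks the [j]-th Taylor
    coefficient, since every other term has a nonzero frequency [k - j]. *)
Lemma fourier_analytic (c : nat -> C) (h : C -> C) (r ga : R) (j : nat)
  (hr : 0 < r < 1) (hj : (1 <= j)%nat)
  (hh : forall z : C, unit_disk z ->
     is_series (V := C_NormedModule) (fun k : nat => (c (S k) * z ^ (S k))%C) (h z)) :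
  is_RInt (fun t => Re (cis (- (INR j * t + ga)) * h (r * cis t))%C) 0 (2 * PI)
    (2 * PI * (r ^ j * Re (cis (- ga) * c j)%C)).
Proof.
  destruct j as [|j]; [lia|].
  set (I := fun k : nat => if Nat.eq_dec k j
      then 2 * PI * (r ^ S j * Re (cis (- ga) * c (S j))%C) else 0).
  apply is_RInt_series with
    (f := fun k t => Re (cis (- (INR (S j) * t + ga)) * (c (S k) * (r * cis t) ^ S k))%C)
    (M := fun k => Cmod (c (S k)) * r ^ S k) (I := I).
  - intros k t. destruct (polar_form (c (S k))) as [th Hth].
    rewrite (monomial_polar _ r t th _ Hth), Re_cis_scal.
    apply Rabs_scal_cos, Rmult_le_pos; [apply Cmod_ge_0|apply pow_le; lra].
  - now apply ex_series_inside with h.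
  - intros k. destruct (polar_form (c (S k))) as [th Hth].
    apply is_RInt_ext with
      (fun t => scal (Cmod (c (S k)) * r ^ S k) (cos ((INR (S k) - INR (S j)) * t + (th - ga)))).
    { intros t _. rewrite (monomial_polar _ r t th _ Hth), Re_cis_scal.
      replace (INR (S k) * t + th + - (INR (S j) * t + ga))
        with ((INR (S k) - INR (S j)) * t + (th - ga)) by ring.
      reflexivity. }
    unfold I. destruct (Nat.eq_dec k j) as [->|Hk].
    + apply is_RInt_ext with
        (fun t => Cmod (c (S j)) * r ^ S j * cos (th - ga)).
      { intros t _. replace ((INR (S j) - INR (S j)) * t + (th - ga)) with (th - ga) by ring.
        reflexivity. }
      replace (2 * PI * (r ^ S j * Re (cis (- ga) * c (S j))%C))
        with (scal (2 * PI - 0) (Cmod (c (S j)) * r ^ S j * cos (th - ga))).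
      * apply (is_RInt_const (V := R_NormedModule)).
      * rewrite Hth at 2. rewrite Re_cis_scal. as_real.
        unfold Rminus. ring.
    + replace 0 with (scal (Cmod (c (S k)) * r ^ S k) 0) at 2
        by apply (scal_zero_r (V := R_NormedModule)).
      apply (is_RInt_scal (V := R_NormedModule)).
      apply is_RInt_cos_period. lia.
  - intros t. apply is_series_Re_mult, hh. now apply polar_in_disk.
  - replace (2 * PI * (r ^ S j * Re (cis (- ga) * c (S j))%C)) with (I j).
    + apply is_series_single. intros k Hk. unfold I. now destruct (Nat.eq_dec k j).
    + unfold I. now destruct (Nat.eq_dec j j).
Qed.

(** Conjugate powers only have the negative frequencies [-(k + 1) - j] after
    multiplication by [exp (-i j t)], so nothing survives the integration. *)
Lemma fourier_antianalytic (c : nat -> C) (h : C -> C) (r ga : R) (j : nat)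
  (hr : 0 < r < 1)
  (hh : forall z : C, unit_disk z ->
     is_series (V := C_NormedModule) (fun k : nat => (c (S k) * z ^ (S k))%C) (h z)) :
  is_RInt (fun t => Re (cis (- (INR j * t + ga)) * Cconj (h (r * cis t)))%C) 0 (2 * PI) 0.
Proof.
  apply is_RInt_series with
    (f := fun k t => Re (cis (- (INR j * t + ga)) * Cconj (c (S k) * (r * cis t) ^ S k))%C)
    (M := fun k => Cmod (c (S k)) * r ^ S k) (I := fun _ => 0).
  - intros k t. destruct (polar_form (c (S k))) as [th Hth].
    rewrite (monomial_polar _ r t th _ Hth), Cmult_conj, Cconj_RtoC, Cconj_cis, Re_cis_scal.
    apply Rabs_scal_cos, Rmult_le_pos; [apply Cmod_ge_0|apply pow_le; lra].
  - now apply ex_series_inside with h.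
  - intros k. destruct (polar_form (c (S k))) as [th Hth].
    apply is_RInt_ext with
      (fun t => scal (Cmod (c (S k)) * r ^ S k) (cos ((INR (S k + j) - INR 0) * t + (th + ga)))).
    { intros t _.
      rewrite (monomial_polar _ r t th _ Hth), Cmult_conj, Cconj_RtoC, Cconj_cis, Re_cis_scal.
      rewrite <- (cos_neg (- (INR (S k) * t + th) + - (INR j * t + ga))).
      replace (- (- (INR (S k) * t + th) + - (INR j * t + ga)))
        with ((INR (S k + j) - INR 0) * t + (th + ga))
        by (rewrite plus_INR; change (INR 0) with 0; ring).
      reflexivity. }
    replace 0 with (scal (Cmod (c (S k)) * r ^ S k) 0) at 2
      by apply (scal_zero_r (V := R_NormedModule)).
    apply (is_RInt_scal (V := R_NormedModule)).
    apply is_RInt_cos_period. lia.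
  - intros t. apply is_series_Re_mult_conj, hh. now apply polar_in_disk.
  - apply (is_series_single (fun _ => 0) 0%nat). easy.
Qed.

Lemma is_RInt_sum_n_m (f : nat -> R -> R) (I : nat -> R) (a b : R) (p : nat) :
  (forall n, (1 <= n <= p)%nat -> is_RInt (f n) a b (I n)) ->
  is_RInt (fun t => sum_n_m (fun n => f n t) 1 p) a b (sum_n_m I 1 p).
Proof.
  induction p as [|p IH]; intros H.
  - apply is_RInt_ext with (fun _ => 0).
    { intros; now rewrite sum_n_m_zero by lia. }
    rewrite sum_n_m_zero by lia.
    replace (@zero R_AbelianMonoid) with (scal (b - a) 0)
      by apply (scal_zero_r (V := R_NormedModule)).
    apply (is_RInt_const (V := R_NormedModule)).
  - apply is_RInt_ext with (fun t => plus (sum_n_m (fun n => f n t) 1 p) (f (S p) t)).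
    { intros; now rewrite sum_n_Sm by lia. }
    rewrite sum_n_Sm by lia.
    apply (is_RInt_plus (V := R_NormedModule)).
    + apply IH. intros n Hn; apply H; lia.
    + apply H; lia.
Qed.

Lemma Re_mult_sum_n_m (u : C) (f : nat -> C) (p : nat) :
  Re (u * sum_n_m (G := C_AbelianMonoid) f 1 p)%C = sum_n_m (fun n => Re (u * f n)%C) 1 p.
Proof.
  induction p as [|p IH].
  - rewrite !sum_n_m_zero by lia. unfold zero, Re, Cmult; simpl. ring.
  - rewrite !sum_n_Sm, <- IH by lia. unfold plus, Re, Cmult; simpl. ring.
Qed.

(** On a circle the factors [|z|^(2(n-1))] are constant, so the analytic and
    antianalytic cases add up. *)
Lemma fourier_polyharmonic (p : nat) (F : C -> C) (h g : nat -> C -> C) (a b : nat -> nat -> C)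
  (hh : forall (n : nat) (z : C), (1 <= n <= p)%nat -> unit_disk z ->
     is_series (V := C_NormedModule) (fun k : nat => (a n (S k) * z ^ (S k))%C) (h n z))
  (hg : forall (n : nat) (z : C), (1 <= n <= p)%nat -> unit_disk z ->
     is_series (V := C_NormedModule) (fun k : nat => (b n (S k) * z ^ (S k))%C) (g n z))
  (hF : forall z : C, unit_disk z ->
     F z = sum_n_m (G := C_AbelianMonoid)
             (fun n : nat => (RtoC (Cmod z ^ (2 * (n - 1))) * (h n z + Cconj (g n z)))%C)
             1 p)
  (j : nat) (r ga : R) (hj : (1 <= j)%nat) (hr : 0 < r < 1) :
  is_RInt (fun t => Re (cis (- (INR j * t + ga)) * F (r * cis t))%C) 0 (2 * PI)
    (sum_n_m (fun n => 2 * PI * Re (cis (- ga) * a n j)%C * r ^ (2 * (n - 1) + j)) 1 p).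
Proof.
  apply is_RInt_ext with (fun t => sum_n_m (fun n =>
      plus (scal (r ^ (2 * (n - 1))) (Re (cis (- (INR j * t + ga)) * h n (r * cis t))%C))
           (scal (r ^ (2 * (n - 1)))
              (Re (cis (- (INR j * t + ga)) * Cconj (g n (r * cis t)))%C))) 1 p).
  { intros t _. rewrite hF by now apply polar_in_disk.
    rewrite Re_mult_sum_n_m. apply sum_n_m_ext. intros n.
    rewrite Cmod_polar by lra.
    as_real.
    unfold Re, Cmult, Cplus, RtoC; simpl. ring. }
  apply is_RInt_sum_n_m. intros n Hn.
  replace (2 * PI * Re (cis (- ga) * a n j)%C * r ^ (2 * (n - 1) + j)) with
    (plus (scal (r ^ (2 * (n - 1))) (2 * PI * (r ^ j * Re (cis (- ga) * a n j)%C)))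
          (scal (r ^ (2 * (n - 1))) 0)).
  2:{ as_real. rewrite pow_add. ring. }
  apply (is_RInt_plus (V := R_NormedModule)); apply (is_RInt_scal (V := R_NormedModule)).
  - apply fourier_analytic; [easy|easy|]. intros z Hz; now apply hh.
  - apply fourier_antianalytic with (b n); [easy|]. intros z Hz; now apply hg.
Qed.

(** * Mappings of class C^1 *)

Lemma continuous_Re (z : C) : continuous (T := C_UniformSpace) (U := R_UniformSpace) Re z.
Proof. destruct z as [x y]. apply (continuous_fst (U := R_UniformSpace) (V := R_UniformSpace)). Qed.

Lemma continuous_Im (z : C) : continuous (T := C_UniformSpace) (U := R_UniformSpace) Im z.
Proof. destruct z as [x y]. apply (continuous_snd (U := R_UniformSpace) (V := R_UniformSpace)). Qed.

Lemma continuous_Re_Im (T : UniformSpace) (f : T -> C) (x : T) :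
  continuous (U := R_UniformSpace) (fun y => Re (f y)) x ->
  continuous (U := R_UniformSpace) (fun y => Im (f y)) x ->
  continuous (U := C_UniformSpace) f x.
Proof.
  intros H1 H2.
  apply (continuous_ext (U := C_UniformSpace) (fun y => (Re (f y), Im (f y)))).
  - intros y. now destruct (f y).
  - apply (continuous_comp_2 (V := R_UniformSpace) (W := R_UniformSpace) (X := C_UniformSpace)
      (fun y => Re (f y)) (fun y => Im (f y)) (fun u v => (u, v)) x H1 H2).
    apply (continuous_ext (U := C_UniformSpace) (fun z => z)); [now intros [u v]|].
    apply continuous_id.
Qed.

Lemma continuous_Cmult (T : UniformSpace) (f g : T -> C) (x : T) :
  continuous (U := C_UniformSpace) f x -> continuous (U := C_UniformSpace) g x ->
  continuous (U := C_UniformSpace) (fun y => (f y * g y)%C) x.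
Proof.
  intros Hf Hg.
  assert (Hfr := continuous_comp f Re x Hf (continuous_Re (f x))).
  assert (Hfi := continuous_comp f Im x Hf (continuous_Im (f x))).
  assert (Hgr := continuous_comp g Re x Hg (continuous_Re (g x))).
  assert (Hgi := continuous_comp g Im x Hg (continuous_Im (g x))).
  apply continuous_Re_Im.
  - apply (continuous_minus (V := R_NormedModule)
      (fun y => Re (f y) * Re (g y)) (fun y => Im (f y) * Im (g y)));
    now apply (continuous_mult (K := R_AbsRing)).
  - apply (continuous_plus (V := R_NormedModule)
      (fun y => Re (f y) * Im (g y)) (fun y => Im (f y) * Re (g y)));
    now apply (continuous_mult (K := R_AbsRing)).
Qed.

Lemma continuous_Cplus (T : UniformSpace) (f g : T -> C) (x : T) :
  continuous (U := C_UniformSpace) f x -> continuous (U := C_UniformSpace) g x ->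
  continuous (U := C_UniformSpace) (fun y => (f y + g y)%C) x.
Proof. apply (continuous_plus (V := C_R_NormedModule)). Qed.

Lemma continuous_Cminus (T : UniformSpace) (f g : T -> C) (x : T) :
  continuous (U := C_UniformSpace) f x -> continuous (U := C_UniformSpace) g x ->
  continuous (U := C_UniformSpace) (fun y => (f y - g y)%C) x.
Proof. apply (continuous_minus (V := C_R_NormedModule)). Qed.

Lemma continuous_RtoC (T : UniformSpace) (f : T -> R) (x : T) :
  continuous (U := R_UniformSpace) f x ->
  continuous (U := C_UniformSpace) (fun y => RtoC (f y)) x.
Proof. intros H. apply continuous_Re_Im; [exact H|apply continuous_const]. Qed.

Lemma continuous_cis (T : UniformSpace) (f : T -> R) (x : T) :
  continuous (U := R_UniformSpace) f x ->
  continuous (U := C_UniformSpace) (fun y => cis (f y)) x.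
Proof.
  intros H. apply continuous_Re_Im.
  - apply (continuous_comp (V := R_UniformSpace) (W := R_UniformSpace) f cos);
      [exact H|apply continuous_cos].
  - apply (continuous_comp (V := R_UniformSpace) (W := R_UniformSpace) f sin);
      [exact H|apply continuous_sin].
Qed.

Lemma continuous_Cmod (z : C) :
  continuous (T := C_UniformSpace) (U := R_UniformSpace) Cmod z.
Proof.
  apply (continuous_comp (U := C_UniformSpace) (V := R_UniformSpace) (W := R_UniformSpace)
    (fun z : C => fst z ^ 2 + snd z ^ 2) sqrt).
  - apply (continuous_plus (U := C_UniformSpace) (V := R_NormedModule)
      (fun z : C => fst z ^ 2) (fun z : C => snd z ^ 2)).
    + apply (continuous_comp (U := C_UniformSpace) (V := R_UniformSpace) (W := R_UniformSpace)
        Re (fun x => x ^ 2)); [apply continuous_Re|].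
      apply (ex_derive_continuous (K := R_AbsRing) (V := R_NormedModule)). auto_derive; easy.
    + apply (continuous_comp (U := C_UniformSpace) (V := R_UniformSpace) (W := R_UniformSpace)
        Im (fun x => x ^ 2)); [apply continuous_Im|].
      apply (ex_derive_continuous (K := R_AbsRing) (V := R_NormedModule)). auto_derive; easy.
  - apply continuous_sqrt.
Qed.

Lemma open_unit_disk : open (T := C_UniformSpace) unit_disk.
Proof.
  apply (open_comp (T := C_UniformSpace) (U := R_UniformSpace) Cmod (fun u => u < 1)).
  - intros z _. apply continuous_Cmod.
  - apply open_lt.
Qed.

Lemma ex_derive_Re (f : R -> C) (x : R) :
  ex_derive (V := C_R_NormedModule) f x -> ex_derive (fun t => Re (f t)) x.
Proof.
  intros [l H]. exists (Re l).
  apply (filterdiff_comp' (K := R_AbsRing) (U := R_NormedModule) (V := C_R_NormedModule)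
    (W := R_NormedModule) f Re x _ Re H).
  apply (filterdiff_linear (U := C_R_NormedModule)), (is_linear_fst (U := R_NormedModule) (V := R_NormedModule)).
Qed.

Lemma ex_derive_Im (f : R -> C) (x : R) :
  ex_derive (V := C_R_NormedModule) f x -> ex_derive (fun t => Im (f t)) x.
Proof.
  intros [l H]. exists (Im l).
  apply (filterdiff_comp' (K := R_AbsRing) (U := R_NormedModule) (V := C_R_NormedModule)
    (W := R_NormedModule) f Im x _ Im H).
  apply (filterdiff_linear (U := C_R_NormedModule)), (is_linear_snd (U := R_NormedModule) (V := R_NormedModule)).
Qed.

Lemma differentiable_of_continuous_partial (U : C -> Prop) (f fx fy : R -> R -> R) (x y : R) :
  open (T := C_UniformSpace) U -> U (x, y) ->
  (forall s t, U (s, t) -> is_derive (fun u => f u t) s (fx s t) /\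
                           is_derive (fun u => f s u) t (fy s t)) ->
  continuous (T := C_UniformSpace) (U := R_UniformSpace) (fun z => fx (fst z) (snd z)) (x, y) ->
  differentiable_pt_lim f x y (fx x y) (fy x y).
Proof.
  intros HU Hxy Hd Hc.
  apply filterdiff_differentiable_pt_lim.
  apply (is_derive_filterdiff f x y fx (fy x y)).
  - generalize (HU _ Hxy). apply filter_imp. intros [s t] Hst. now apply Hd.
  - now apply Hd.
  - exact Hc.
Qed.

(** Continuity of the first partial derivative together with existence of the
    second one already makes each component totally differentiable, which is
    what the chain rule in polar coordinates needs. *)
Lemma smooth1_differentiable (U : C -> Prop) (F : C -> C) (x y : R) :
  open (T := C_UniformSpace) U -> smooth_on 1 U F -> U (x, y) ->
  differentiable_pt_lim (fun s t => Re (F (s, t))) x y (Re (dx F (x, y))) (Re (dy F (x, y))) /\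
  differentiable_pt_lim (fun s t => Im (F (s, t))) x y (Im (dx F (x, y))) (Im (dy F (x, y))).
Proof.
  intros HU [Hp [Hx Hy]] Hxy. specialize (Hx _ Hxy).
  split.
  - apply (differentiable_of_continuous_partial U _
      (fun s t => Re (dx F (s, t))) (fun s t => Re (dy F (s, t)))); [easy|easy| |].
    + intros s t Hst. destruct (Hp _ Hst) as [H1 H2].
      apply ex_derive_Re in H1. apply ex_derive_Re in H2.
      split; [exact (Derive_correct _ _ H1)|exact (Derive_correct _ _ H2)].
    + apply (continuous_ext (T := C_UniformSpace) (fun z : C => Re (dx F z))).
      * now intros [s t].
      * apply (continuous_comp (U := C_UniformSpace) (V := C_UniformSpace) (dx F) Re);
          [exact Hx|apply continuous_Re].
  - apply (differentiable_of_continuous_partial U _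
      (fun s t => Im (dx F (s, t))) (fun s t => Im (dy F (s, t)))); [easy|easy| |].
    + intros s t Hst. destruct (Hp _ Hst) as [H1 H2].
      apply ex_derive_Im in H1. apply ex_derive_Im in H2.
      split; [exact (Derive_correct _ _ H1)|exact (Derive_correct _ _ H2)].
    + apply (continuous_ext (T := C_UniformSpace) (fun z : C => Im (dx F z))).
      * now intros [s t].
      * apply (continuous_comp (U := C_UniformSpace) (V := C_UniformSpace) (dx F) Im);
          [exact Hx|apply continuous_Im].
Qed.

Lemma smooth1_continuous (U : C -> Prop) (F : C -> C) (z : C) :
  open (T := C_UniformSpace) U -> smooth_on 1 U F -> U z ->
  continuous (T := C_UniformSpace) (U := C_UniformSpace) F z.
Proof.
  destruct z as [x y]. intros HU HF Hz.
  destruct (smooth1_differentiable U F x y HU HF Hz) as [H1 H2].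
  apply continuous_Re_Im.
  - apply (continuous_ext (T := C_UniformSpace) (fun z : C => Re (F (fst z, snd z)))).
    { now intros [s t]. }
    apply (proj1 (continuity_2d_pt_filterlim (fun s t => Re (F (s, t))) x y)).
    apply differentiable_continuity_pt. eexists; eexists; exact H1.
  - apply (continuous_ext (T := C_UniformSpace) (fun z : C => Im (F (fst z, snd z)))).
    { now intros [s t]. }
    apply (proj1 (continuity_2d_pt_filterlim (fun s t => Im (F (s, t))) x y)).
    apply differentiable_continuity_pt. eexists; eexists; exact H2.
Qed.

(** The class [smooth_on k] only asks continuity of the derivatives of order
    exactly [k]; the lower ones are continuous because they are differentiable.
    This brings the class C^(2p) of a polyharmonic mapping down to C^1. *)
Lemma smooth_on_pred (k : nat) (U : C -> Prop) (F : C -> C) :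
  open (T := C_UniformSpace) U -> smooth_on (S k) U F -> smooth_on k U F.
Proof.
  intros HU. revert F. induction k as [|k IH]; intros F H.
  - intros z Hz. now apply smooth1_continuous with U.
  - destruct H as [Hp [Hx Hy]]. split; [exact Hp|]. split; apply IH; assumption.
Qed.

Lemma smooth_on_le (k m : nat) (U : C -> Prop) (F : C -> C) :
  open (T := C_UniformSpace) U -> (k <= m)%nat -> smooth_on m U F -> smooth_on k U F.
Proof. intros HU Hkm. induction Hkm; [easy|]. intros H. now apply IHHkm, smooth_on_pred. Qed.

(** Chain rule along the plane curve [(u, v)]. *)
Lemma smooth1_derive_along (U : C -> Prop) (F : C -> C) (u v : R -> R) (s du dv : R) :
  open (T := C_UniformSpace) U -> smooth_on 1 U F -> U (u s, v s) ->
  is_derive u s du -> is_derive v s dv ->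
  is_derive (fun x => Re (F (u x, v x))) s
    (Re (du * dx F (u s, v s) + dv * dy F (u s, v s))%C) /\
  is_derive (fun x => Im (F (u x, v x))) s
    (Im (du * dx F (u s, v s) + dv * dy F (u s, v s))%C).
Proof.
  intros HU HF Hs Hu Hv.
  destruct (smooth1_differentiable U F _ _ HU HF Hs) as [H1 H2].
  apply is_derive_Reals in Hu. apply is_derive_Reals in Hv.
  split; apply is_derive_Reals.
  - replace (Re (du * dx F (u s, v s) + dv * dy F (u s, v s))%C)
      with (Re (dx F (u s, v s)) * du + Re (dy F (u s, v s)) * dv)
      by (unfold Re, RtoC, Cplus, Cmult; simpl; ring).
    now apply (derivable_pt_lim_comp_2d (fun x y => Re (F (x, y)))).
  - replace (Im (du * dx F (u s, v s) + dv * dy F (u s, v s))%C)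
      with (Im (dx F (u s, v s)) * du + Im (dy F (u s, v s)) * dv)
      by (unfold Im, RtoC, Cplus, Cmult; simpl; ring).
    now apply (derivable_pt_lim_comp_2d (fun x y => Im (F (x, y)))).
Qed.

(** * Fourier coefficients of z F_z *)

Definition radial_derivative (F : C -> C) (r t : R) : C :=
  (cos t * dx F (r * cis t) + sin t * dy F (r * cis t))%C.

Definition angular_derivative (F : C -> C) (r t : R) : C :=
  (RtoC (- r * sin t) * dx F (r * cis t) + RtoC (r * cos t) * dy F (r * cis t))%C.

Lemma Dz_polar (F : C -> C) (r t : R) :
  (2 * (r * cis t) * Dz F (r * cis t))%C =
  (r * radial_derivative F r t - Ci * angular_derivative F r t)%C.
Proof.
  unfold Dz, radial_derivative, angular_derivative.
  set (X := dx F _). set (Y := dy F _).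
  apply injective_projections; unfold Ci, cis, RtoC, Cmult, Cminus, Copp, Cplus, Cdiv, Cinv;
    simpl; field.
Qed.

Lemma is_derive_radial (F : C -> C) (u : C) (r t : R) :
  smooth_on 1 unit_disk F -> 0 < r < 1 ->
  is_derive (fun s : R => Re (u * F (s * cis t))%C) r (Re (u * radial_derivative F r t)%C).
Proof.
  intros HF Hr.
  destruct (smooth1_derive_along unit_disk F (fun s => s * cos t) (fun s => s * sin t) r
    (cos t) (sin t) open_unit_disk HF) as [H1 H2].
  - rewrite <- polar_point. now apply polar_in_disk.
  - auto_derive; [easy|ring].
  - auto_derive; [easy|ring].
  - rewrite <- polar_point in H1, H2. fold (radial_derivative F r t) in H1, H2.
    apply is_derive_ext with
      (fun s => Re u * Re (F (s * cos t, s * sin t)) - Im u * Im (F (s * cos t, s * sin t))).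
    { intros s. rewrite polar_point. reflexivity. }
    exact (is_derive_minus (V := R_NormedModule) _ _ r _ _
      (is_derive_scal _ r (Re u) _ H1) (is_derive_scal _ r (Im u) _ H2)).
Qed.

(** The factor [exp (-i (j t + ga))] contributes [-i j] times the function
    itself, whose imaginary part is [- j Re]. *)
Lemma is_derive_angular (F : C -> C) (r ga : R) (j : nat) (t : R) :
  smooth_on 1 unit_disk F -> 0 < r < 1 ->
  is_derive (fun s : R => Im (cis (- (INR j * s + ga)) * F (r * cis s))%C) t
    (Im (cis (- (INR j * t + ga)) * angular_derivative F r t)%C
     - INR j * Re (cis (- (INR j * t + ga)) * F (r * cis t))%C).
Proof.
  intros HF Hr.
  destruct (smooth1_derive_along unit_disk F (fun s => r * cos s) (fun s => r * sin s) t
    (- r * sin t) (r * cos t) open_unit_disk HF) as [H1 H2].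
  - rewrite <- polar_point. now apply polar_in_disk.
  - auto_derive; [easy|ring].
  - auto_derive; [easy|ring].
  - rewrite <- polar_point in H1, H2. fold (angular_derivative F r t) in H1, H2.
    apply is_derive_ext with
      (fun s => cos (- (INR j * s + ga)) * Im (F (r * cos s, r * sin s))
              + sin (- (INR j * s + ga)) * Re (F (r * cos s, r * sin s))).
    { intros s. rewrite polar_point. unfold cis, Cmult, Re, Im; simpl. reflexivity. }
    assert (Hc : is_derive (fun s => cos (- (INR j * s + ga))) t
                   (INR j * sin (- (INR j * t + ga)))) by (auto_derive; [easy|ring]).
    assert (Hs : is_derive (fun s => sin (- (INR j * s + ga))) t
                   (- INR j * cos (- (INR j * t + ga)))) by (auto_derive; [easy|ring]).
    pose proof (is_derive_plus (V := R_NormedModule) _ _ t _ _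
      (is_derive_mult _ _ t _ _ Hc H2 Rmult_comm) (is_derive_mult _ _ t _ _ Hs H1 Rmult_comm)) as H.
    match type of H with is_derive _ _ ?l =>
      match goal with |- is_derive _ _ ?m => replace m with l; [exact H|] end end.
    as_real. rewrite polar_point. unfold cis, Cmult, Re, Im; simpl. ring.
Qed.

Lemma continuous_polar (T : UniformSpace) (G : C -> C) (rho tau : T -> R) (x : T) :
  (forall z, unit_disk z -> continuous (T := C_UniformSpace) (U := C_UniformSpace) G z) ->
  0 < rho x < 1 ->
  continuous (U := R_UniformSpace) rho x -> continuous (U := R_UniformSpace) tau x ->
  continuous (U := C_UniformSpace) (fun y => G (rho y * cis (tau y))%C) x.
Proof.
  intros HG Hx Hr Ht.
  apply (continuous_comp (V := C_UniformSpace) (W := C_UniformSpace)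
    (fun y => (rho y * cis (tau y))%C) G).
  - apply continuous_Cmult; [now apply continuous_RtoC|now apply continuous_cis].
  - apply HG. now apply polar_in_disk.
Qed.

Lemma continuous_radial_derivative (T : UniformSpace) (F : C -> C) (rho tau : T -> R) (x : T) :
  smooth_on 1 unit_disk F -> 0 < rho x < 1 ->
  continuous (U := R_UniformSpace) rho x -> continuous (U := R_UniformSpace) tau x ->
  continuous (U := C_UniformSpace) (fun y => radial_derivative F (rho y) (tau y)) x.
Proof.
  intros [_ [Hx Hy]] Hr Cr Ct. unfold radial_derivative.
  apply continuous_Cplus; apply continuous_Cmult;
    [apply continuous_RtoC|now apply continuous_polar
    |apply continuous_RtoC|now apply continuous_polar].
  - apply (continuous_comp (V := R_UniformSpace) (W := R_UniformSpace) tau cos);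
      [exact Ct|apply continuous_cos].
  - apply (continuous_comp (V := R_UniformSpace) (W := R_UniformSpace) tau sin);
      [exact Ct|apply continuous_sin].
Qed.

Lemma continuous_phase (j : nat) (ga t : R) :
  continuous (T := R_UniformSpace) (U := R_UniformSpace) (fun s => - (INR j * s + ga)) t.
Proof.
  apply (ex_derive_continuous (K := R_AbsRing) (V := R_NormedModule)). auto_derive; easy.
Qed.

Lemma continuous_angular_derivative (F : C -> C) (r t : R) :
  smooth_on 1 unit_disk F -> 0 < r < 1 ->
  continuous (T := R_UniformSpace) (U := C_UniformSpace) (angular_derivative F r) t.
Proof.
  intros [_ [Hx Hy]] Hr. unfold angular_derivative.
  apply continuous_Cplus; apply continuous_Cmult.
  - apply continuous_RtoC.
    apply (ex_derive_continuous (K := R_AbsRing) (V := R_NormedModule)). auto_derive; easy.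
  - apply (continuous_polar R_UniformSpace (dx F) (fun _ => r) (fun s => s));
      [easy|easy|apply continuous_const|apply continuous_id].
  - apply continuous_RtoC.
    apply (ex_derive_continuous (K := R_AbsRing) (V := R_NormedModule)). auto_derive; easy.
  - apply (continuous_polar R_UniformSpace (dy F) (fun _ => r) (fun s => s));
      [easy|easy|apply continuous_const|apply continuous_id].
Qed.

(** Integration by parts over a period: the boundary terms agree, so the
    angular derivative multiplies the [j]-th coefficient by [j] (up to the
    factor [i], hidden in the passage from [Re] to [Im]). *)
Lemma angular_integral (F : C -> C) (r ga A : R) (j : nat) :
  smooth_on 1 unit_disk F -> 0 < r < 1 ->
  is_RInt (fun t : R => Re (cis (- (INR j * t + ga)) * F (r * cis t))%C) 0 (2 * PI) A ->
  is_RInt (fun t => Im (cis (- (INR j * t + ga)) * angular_derivative F r t)%C) 0 (2 * PI)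
    (INR j * A).
Proof.
  intros HF Hr HA.
  set (q := fun s : R => Im (cis (- (INR j * s + ga)) * F (r * cis s))%C).
  assert (HFc := fun z => smooth1_continuous unit_disk F z open_unit_disk HF).
  assert (Hq : is_RInt (fun t => Im (cis (- (INR j * t + ga)) * angular_derivative F r t)%C
     - INR j * Re (cis (- (INR j * t + ga)) * F (r * cis t))%C) 0 (2 * PI)
     (minus (q (2 * PI)) (q 0))).
  { apply (is_RInt_derive (V := R_CompleteNormedModule) q).
    - intros t _. now apply is_derive_angular.
    - intros t _.
      apply (continuous_minus (V := R_NormedModule)).
      + apply (continuous_comp (U := R_UniformSpace) (V := C_UniformSpace) _ Im); [|apply continuous_Im].
        apply continuous_Cmult; [apply continuous_cis, continuous_phase|].
        now apply continuous_angular_derivative.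
      + apply (continuous_scal_r (V := R_NormedModule) (INR j)).
        apply (continuous_comp (U := R_UniformSpace) (V := C_UniformSpace) _ Re); [|apply continuous_Re].
        apply continuous_Cmult; [apply continuous_cis, continuous_phase|].
        apply (continuous_polar R_UniformSpace F (fun _ => r) (fun s => s));
          [easy|easy|apply continuous_const|apply continuous_id]. }
  replace (minus (q (2 * PI)) (q 0)) with 0 in Hq.
  2:{ unfold q. replace (cis (2 * PI)) with (cis 0).
      2:{ unfold cis. now rewrite cos_2PI, sin_2PI, cos_0, sin_0. }
      replace (cis (- (INR j * (2 * PI) + ga))) with (cis (- (INR j * 0 + ga))).
      2:{ unfold cis. rewrite <- (cos_period (- (INR j * (2 * PI) + ga)) j),
            <- (sin_period (- (INR j * (2 * PI) + ga)) j).
          f_equal; f_equal; ring. }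
      symmetry. apply (minus_eq_zero (G := R_AbelianGroup)). }
  apply is_RInt_ext with (fun t => plus
    (Im (cis (- (INR j * t + ga)) * angular_derivative F r t)%C
     - INR j * Re (cis (- (INR j * t + ga)) * F (r * cis t))%C)
    (scal (INR j) (Re (cis (- (INR j * t + ga)) * F (r * cis t))%C))).
  { intros t _. as_real. ring. }
  replace (INR j * A) with (plus 0 (scal (INR j) A)) by (as_real; ring).
  apply (is_RInt_plus (V := R_NormedModule)); [exact Hq|].
  now apply (is_RInt_scal (V := R_NormedModule)).
Qed.

Lemma locally_unit_interval (r : R) : 0 < r < 1 -> locally r (fun s : R => 0 < s < 1).
Proof.
  intros Hr. apply (locally_open (T := R_UniformSpace) (fun s => 0 < s /\ s < 1)).
  - apply open_and; [apply open_gt|apply open_lt].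
  - easy.
  - exact Hr.
Qed.

(** Differentiation under the integral sign.  The coefficient [A] is only
    known as a function of the radius, and uniqueness of its derivative
    identifies the integral. *)
Lemma radial_integral (F : C -> C) (A : R -> R) (r ga dA : R) (j : nat) :
  smooth_on 1 unit_disk F -> 0 < r < 1 ->
  (forall s, 0 < s < 1 ->
    is_RInt (fun t : R => Re (cis (- (INR j * t + ga)) * F (s * cis t))%C) 0 (2 * PI) (A s)) ->
  is_derive A r dA ->
  is_RInt (fun t : R => Re (cis (- (INR j * t + ga)) * radial_derivative F r t)%C) 0 (2 * PI) dA.
Proof.
  intros HF Hr HA HdA.
  set (w := fun s t : R => Re (cis (- (INR j * t + ga)) * F (s * cis t))%C).
  assert (Dw : forall s t, 0 < s < 1 -> is_derive (fun x => w x t) s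
     (Re (cis (- (INR j * t + ga)) * radial_derivative F s t)%C)).
  { intros s t Hs. now apply is_derive_radial. }
  assert (D : is_derive (fun s => RInt (fun t => w s t) 0 (2 * PI)) r
     (RInt (fun t => Derive (fun s => w s t) r) 0 (2 * PI))).
  { apply is_derive_RInt_param.
    - generalize (locally_unit_interval r Hr). apply filter_imp.
      intros s Hs t _. eexists. now apply Dw.
    - intros t _.
      apply continuity_2d_pt_ext_loc with
        (fun s t : R => Re (cis (- (INR j * t + ga)) * radial_derivative F s t)%C).
      + destruct (locally_unit_interval r Hr) as [d Hd].
        exists d. intros s v Hs _. symmetry. apply is_derive_unique, Dw, Hd, Hs.
      + apply continuity_2d_pt_filterlim.
        change (continuous (T := prod_UniformSpace R_UniformSpace R_UniformSpace)
          (U := R_UniformSpace) (fun z : R * R => Re (cis (- (INR j * snd z + ga))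
            * radial_derivative F (fst z) (snd z))%C) (r, t)).
        apply (continuous_comp (U := prod_UniformSpace R_UniformSpace R_UniformSpace)
          (V := C_UniformSpace) (W := R_UniformSpace)
          (fun z : R * R => (cis (- (INR j * snd z + ga)) * radial_derivative F (fst z) (snd z))%C) Re);
          [|apply continuous_Re].
        apply continuous_Cmult.
        * apply continuous_cis.
          apply (continuous_comp (U := prod_UniformSpace R_UniformSpace R_UniformSpace)
            (V := R_UniformSpace) (W := R_UniformSpace) snd (fun s => - (INR j * s + ga)));
            [apply continuous_snd|apply continuous_phase].
        * apply continuous_radial_derivative;
            [easy|easy|apply continuous_fst|apply continuous_snd].
    - generalize (locally_unit_interval r Hr). apply filter_imp.
      intros s Hs. exists (A s). now apply HA. }
  assert (E : RInt (fun t => Re (cis (- (INR j * t + ga)) * radial_derivative F r t)%C)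
    0 (2 * PI) = dA).
  { transitivity (RInt (fun t => Derive (fun s => w s t) r) 0 (2 * PI)).
    - apply RInt_ext. intros t _. symmetry. now apply is_derive_unique, Dw.
    - rewrite <- (is_derive_unique _ _ _ D), <- (is_derive_unique _ _ _ HdA).
      apply Derive_ext_loc.
      generalize (locally_unit_interval r Hr). apply filter_imp.
      intros s Hs. now apply is_RInt_unique, HA. }
  rewrite <- E. apply (RInt_correct (V := R_CompleteNormedModule)).
  apply (ex_RInt_continuous (V := R_CompleteNormedModule)). intros t _.
  apply (continuous_comp (U := R_UniformSpace) (V := C_UniformSpace) _ Re); [|apply continuous_Re].
  apply continuous_Cmult; [apply continuous_cis, continuous_phase|].
  apply (continuous_radial_derivative R_UniformSpace F (fun _ => r) (fun s => s));
    [easy|easy|apply continuous_const|apply continuous_id].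
Qed.

(** The operator [2 z d/dz = r d/dr - i d/dt] turns a coefficient [A] into
    [r A' + j A]. *)
Lemma Dz_fourier (F : C -> C) (A : R -> R) (r ga dA : R) (j : nat) :
  smooth_on 1 unit_disk F -> 0 < r < 1 ->
  (forall s, 0 < s < 1 ->
    is_RInt (fun t : R => Re (cis (- (INR j * t + ga)) * F (s * cis t))%C) 0 (2 * PI) (A s)) ->
  is_derive A r dA ->
  is_RInt (fun t => 2 * Re (cis (- (INR j * t + ga)) * ((r * cis t) * Dz F (r * cis t)))%C)
    0 (2 * PI) (r * dA + INR j * A r).
Proof.
  intros HF Hr HA HdA.
  apply is_RInt_ext with (fun t => plus
    (scal r (Re (cis (- (INR j * t + ga)) * radial_derivative F r t)%C))
    (Im (cis (- (INR j * t + ga)) * angular_derivative F r t)%C)).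
  - intros t _. as_real.
    transitivity (Re (cis (- (INR j * t + ga)) * (2 * (r * cis t) * Dz F (r * cis t)))%C).
    + rewrite Dz_polar. unfold Re, Im, RtoC, Ci, Cmult, Cminus, Copp, Cplus; simpl. ring.
    + set (d := Dz F _). unfold cis, Re, RtoC, Cmult; simpl. ring.
  - apply (is_RInt_plus (V := R_NormedModule)).
    + apply (is_RInt_scal (V := R_NormedModule)). now apply radial_integral with A.
    + apply angular_integral; [easy|easy|now apply HA].
Qed.

(** * Coefficient bound for one family *)

Lemma is_derive_sum_n_m (f : nat -> R -> R) (d : nat -> R) (p : nat) (x : R) :
  (forall n, is_derive (f n) x (d n)) ->
  is_derive (fun y => sum_n_m (fun n => f n y) 1 p) x (sum_n_m d 1 p).
Proof.
  intros H. induction p as [|p IH].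
  - apply is_derive_ext with (fun _ => zero).
    { intros; now rewrite sum_n_m_zero by lia. }
    rewrite sum_n_m_zero by lia. apply (is_derive_const (V := R_NormedModule)).
  - apply is_derive_ext with (fun y => plus (sum_n_m (fun n => f n y) 1 p) (f (S p) y)).
    { intros; now rewrite sum_n_Sm by lia. }
    rewrite sum_n_Sm by lia. now apply (is_derive_plus (V := R_NormedModule)).
Qed.

Lemma continuous_Dz (F : C -> C) (z : C) : smooth_on 1 unit_disk F -> unit_disk z ->
  continuous (T := C_UniformSpace) (U := C_UniformSpace) (Dz F) z.
Proof.
  intros [_ [Hx Hy]] Hz. unfold Dz, Cdiv.
  apply (continuous_Cmult C_UniformSpace (fun z => (dx F z - Ci * dy F z)%C) (fun _ => (/ 2)%C)).
  - apply (continuous_Cminus C_UniformSpace (dx F) (fun z => (Ci * dy F z)%C)); [now apply Hx|].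
    apply (continuous_Cmult C_UniformSpace (fun _ => Ci) (dy F)); [apply continuous_const|now apply Hy].
  - apply continuous_const.
Qed.

Lemma continuous_Dzbar (F : C -> C) (z : C) : smooth_on 1 unit_disk F -> unit_disk z ->
  continuous (T := C_UniformSpace) (U := C_UniformSpace) (Dzbar F) z.
Proof.
  intros [_ [Hx Hy]] Hz. unfold Dzbar, Cdiv.
  apply (continuous_Cmult C_UniformSpace (fun z => (dx F z + Ci * dy F z)%C) (fun _ => (/ 2)%C)).
  - apply (continuous_Cplus C_UniformSpace (dx F) (fun z => (Ci * dy F z)%C)); [now apply Hx|].
    apply (continuous_Cmult C_UniformSpace (fun _ => Ci) (dy F)); [apply continuous_const|now apply Hy].
  - apply continuous_const.
Qed.

Lemma continuous_on_circle (G : C -> C) (r t : R) : 0 < r < 1 ->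
  (forall z, unit_disk z -> continuous (T := C_UniformSpace) (U := C_UniformSpace) G z) ->
  continuous (T := R_UniformSpace) (U := C_UniformSpace) (fun t => G (r * cis t)%C) t.
Proof.
  intros Hr HG.
  apply (continuous_polar R_UniformSpace G (fun _ => r) (fun s => s));
    [easy|easy|apply continuous_const|apply continuous_id].
Qed.

Lemma ex_RInt_Cmod (f : R -> C) (a b : R) :
  (forall t, continuous (T := R_UniformSpace) (U := C_UniformSpace) f t) ->
  ex_RInt (fun t => Cmod (f t)) a b.
Proof.
  intros H. apply (ex_RInt_continuous (V := R_CompleteNormedModule)). intros t _.
  apply (continuous_comp (U := R_UniformSpace) (V := C_UniformSpace) f Cmod);
    [apply H|apply continuous_Cmod].
Qed.

(** The coefficient of [z F_z] is at most the mean of its modulus.  The factor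
    [n - 1 + j] is half of [(2(n-1)+j) + j], where [2(n-1)+j] comes from the
    radial derivative of the monomial and [j] from the angular one. *)
Lemma coefficient_sum_le (p : nat) (F : C -> C) (h g : nat -> C -> C) (a b : nat -> nat -> C)
  (HF : smooth_on 1 unit_disk F)
  (hh : forall (n : nat) (z : C), (1 <= n <= p)%nat -> unit_disk z ->
     is_series (V := C_NormedModule) (fun k : nat => (a n (S k) * z ^ (S k))%C) (h n z))
  (hg : forall (n : nat) (z : C), (1 <= n <= p)%nat -> unit_disk z ->
     is_series (V := C_NormedModule) (fun k : nat => (b n (S k) * z ^ (S k))%C) (g n z))
  (hF : forall z : C, unit_disk z ->
     F z = sum_n_m (G := C_AbelianMonoid)
             (fun n : nat => (RtoC (Cmod z ^ (2 * (n - 1))) * (h n z + Cconj (g n z)))%C)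
             1 p)
  (j : nat) (r ga : R) (hj : (1 <= j)%nat) (hr : 0 < r < 1) :
  sum_n_m (fun n => 2 * PI * INR (n - 1 + j) * Re (cis (- ga) * a n j)%C * r ^ (2 * (n - 1) + j)) 1 p
    <= r * RInt (fun t => Cmod (Dz F (r * cis t))) 0 (2 * PI).
Proof.
  set (al := fun n => 2 * PI * Re (cis (- ga) * a n j)%C).
  set (m := fun n => (2 * (n - 1) + j)%nat).
  set (A := fun s => sum_n_m (fun n => al n * s ^ m n) 1 p).
  set (dA := sum_n_m (fun n => al n * (INR (m n) * r ^ pred (m n))) 1 p).
  assert (HdA : is_derive A r dA).
  { apply (is_derive_sum_n_m (fun n s => al n * s ^ m n)). intros n.
    auto_derive; [easy|ring]. }
  assert (HA : forall s, 0 < s < 1 ->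
    is_RInt (fun t : R => Re (cis (- (INR j * t + ga)) * F (s * cis t))%C) 0 (2 * PI) (A s)).
  { intros s Hs. now apply fourier_polyharmonic with h g b. }
  pose proof (Dz_fourier F A r ga dA j HF hr HA HdA) as HI.
  assert (HC : is_RInt (fun t => scal (2 * r) (Cmod (Dz F (r * cis t)))) 0 (2 * PI)
     (scal (2 * r) (RInt (fun t => Cmod (Dz F (r * cis t))) 0 (2 * PI)))).
  { apply (is_RInt_scal (V := R_NormedModule)), (RInt_correct (V := R_CompleteNormedModule)).
    apply ex_RInt_Cmod. intros t. apply continuous_on_circle; [easy|].
    intros z Hz; now apply continuous_Dz. }
  assert (Hle : r * dA + INR j * A r <= 2 * r * RInt (fun t => Cmod (Dz F (r * cis t))) 0 (2 * PI)).
  { refine (is_RInt_le _ _ 0 (2 * PI) _ _ _ HI HC _).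
    - pose proof PI_RGT_0; lra.
    - intros t _. eapply Rle_trans.
      + apply Rmult_le_compat_l; [lra|]. eapply Rle_trans; [apply Rle_abs|apply re_le_Cmod].
      + rewrite !Cmod_mult, Cmod_cis, Cmod_cis, Cmod_R, Rabs_pos_eq by lra.
        apply Req_le. as_real. ring. }
  match goal with |- ?S <= _ => assert (HS : r * dA + INR j * A r = 2 * S) end.
  { unfold dA, A.
    rewrite <- (sum_n_m_mult_l (K := R_Ring) r), <- (sum_n_m_mult_l (K := R_Ring) (INR j)).
    rewrite <- (sum_n_m_mult_l (K := R_Ring) 2).
    rewrite <- (sum_n_m_plus (G := R_AbelianMonoid)).
    apply sum_n_m_ext. intros n. as_real.
    (* The exponent is at least [j >= 1], so it has a true predecessor. *)
    replace (r ^ m n) with (r * r ^ pred (m n)).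
    2:{ replace (m n) with (S (pred (m n))) at 2 by (unfold m; lia). reflexivity. }
    change (r ^ (2 * (n - 1) + j)) with (r ^ m n).
    replace (r ^ m n) with (r * r ^ pred (m n)).
    2:{ replace (m n) with (S (pred (m n))) at 2 by (unfold m; lia). reflexivity. }
    unfold al. replace (INR (n - 1 + j)) with ((INR (m n) + INR j) / 2).
    2:{ unfold m. rewrite !plus_INR, mult_INR. simpl. field. }
    field. }
  lra.
Qed.

(** * The conjugate mapping *)

Definition conj_map (F : C -> C) (z : C) : C := Cconj (F z).

Lemma dx_conj_map (F : C -> C) (z : C) : dx (conj_map F) z = Cconj (dx F z).
Proof.
  unfold dx, conj_map, Cconj; simpl. f_equal.
  apply (Derive_opp (fun t => Im (F (t, Im z)))).
Qed.

Lemma dy_conj_map (F : C -> C) (z : C) : dy (conj_map F) z = Cconj (dy F z).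
Proof.
  unfold dy, conj_map, Cconj; simpl. f_equal.
  apply (Derive_opp (fun t => Im (F (Re z, t)))).
Qed.

(** This is how the bound for [a] in terms of [F_z] also yields the bound for
    [b] in terms of [F_zbar]. *)
Lemma Dz_conj_map (F : C -> C) (z : C) : Dz (conj_map F) z = Cconj (Dzbar F z).
Proof.
  unfold Dz, Dzbar. rewrite dx_conj_map, dy_conj_map.
  set (X := dx F z). set (Y := dy F z).
  apply injective_projections;
    unfold Ci, RtoC, Cmult, Cminus, Copp, Cplus, Cdiv, Cinv, Cconj; simpl; field.
Qed.

Lemma is_linear_Cconj : is_linear (U := C_R_NormedModule) (V := C_R_NormedModule) Cconj.
Proof.
  split.
  - intros x y. apply injective_projections; unfold Cconj; simpl; [easy|].
    unfold plus; simpl; ring.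
  - intros k x. apply injective_projections; unfold Cconj; simpl; [easy|].
    unfold scal; simpl; unfold mult; simpl; ring.
  - exists 1. split; [lra|]. intros x. rewrite Rmult_1_l. apply Req_le.
    unfold norm; simpl. unfold prod_norm, Cconj; simpl.
    change (@norm R_AbsRing R_NormedModule) with Rabs. now rewrite Rabs_Ropp.
Qed.

Lemma continuous_Cconj (z : C) :
  continuous (T := C_UniformSpace) (U := C_UniformSpace) Cconj z.
Proof.
  apply (linear_cont (U := C_R_NormedModule) (V := C_R_NormedModule)), is_linear_Cconj.
Qed.

Lemma ex_derive_Cconj (f : R -> C) (x : R) :
  ex_derive (V := C_R_NormedModule) f x ->
  ex_derive (V := C_R_NormedModule) (fun t => Cconj (f t)) x.
Proof.
  intros [l H]. exists (Cconj l).
  eapply (filterdiff_ext_lin (K := R_AbsRing) (U := R_NormedModule) (V := C_R_NormedModule)).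
  - apply (filterdiff_comp' (K := R_AbsRing) (U := R_NormedModule) (V := C_R_NormedModule)
      (W := C_R_NormedModule) f Cconj x _ Cconj H).
    apply (filterdiff_linear (U := C_R_NormedModule)), is_linear_Cconj.
  - intros y. apply (linear_scal _ is_linear_Cconj).
Qed.

Lemma smooth1_conj_map (U : C -> Prop) (F : C -> C) :
  smooth_on 1 U F -> smooth_on 1 U (conj_map F).
Proof.
  intros [Hp [Hx Hy]]. split; [|split].
  - intros z Hz. destruct (Hp z Hz) as [H1 H2].
    split; now apply ex_derive_Cconj.
  - intros z Hz.
    apply (continuous_ext (T := C_UniformSpace) (U := C_UniformSpace) (fun z => Cconj (dx F z))).
    { intros w. symmetry. apply dx_conj_map. }
    apply (continuous_comp (U := C_UniformSpace) (V := C_UniformSpace) (W := C_UniformSpace));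
      [now apply Hx|apply continuous_Cconj].
  - intros z Hz.
    apply (continuous_ext (T := C_UniformSpace) (U := C_UniformSpace) (fun z => Cconj (dy F z))).
    { intros w. symmetry. apply dy_conj_map. }
    apply (continuous_comp (U := C_UniformSpace) (V := C_UniformSpace) (W := C_UniformSpace));
      [now apply Hy|apply continuous_Cconj].
Qed.

Lemma conj_map_expansion (p : nat) (F : C -> C) (h g : nat -> C -> C)
  (hF : forall z : C, unit_disk z ->
     F z = sum_n_m (G := C_AbelianMonoid)
             (fun n : nat => (RtoC (Cmod z ^ (2 * (n - 1))) * (h n z + Cconj (g n z)))%C)
             1 p) :
  forall z : C, unit_disk z ->
     conj_map F z = sum_n_m (G := C_AbelianMonoid)
             (fun n : nat => (RtoC (Cmod z ^ (2 * (n - 1))) * (g n z + Cconj (h n z)))%C)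
             1 p.
Proof.
  intros z Hz. unfold conj_map. rewrite hF by easy. clear hF.
  induction p as [|p IH].
  - rewrite !sum_n_m_zero by lia. apply injective_projections; simpl; [easy|ring].
  - rewrite !sum_n_Sm, <- IH by lia. set (x := Cmod z ^ _).
    apply injective_projections; unfold plus, Cconj, RtoC, Cmult, Cplus; simpl; ring.
Qed.

(** * The coefficient estimate *)

(** The argument of any nonzero member serves for all, because the quotients
    by it are positive. *)
Lemma common_phase (p : nat) (c : nat -> C) :
  (forall n1 n2 : nat, (1 <= n1 <= p)%nat -> (1 <= n2 <= p)%nat ->
     c n1 <> 0%C -> c n2 <> 0%C -> Rabs (Carg (c n1 / c n2)%C) = 0) ->
  exists ga : R, forall n : nat, (1 <= n <= p)%nat -> Re (cis (- ga) * c n)%C = Cmod (c n).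
Proof.
  intros H.
  destruct (classic (exists n, (1 <= n <= p)%nat /\ c n <> 0%C)) as [[m [Hm Hc]]|Hno].
  - destruct (polar_form (c m)) as [ga Hga]. exists ga. intros n Hn.
    destruct (Ceq_dec (c n) 0) as [E|E].
    { rewrite E, Cmod_0. unfold Re, Cmult; simpl. ring. }
    assert (Q : (c n / c m)%C <> 0%C).
    { intros Q. apply E. replace (c n) with (c n / c m * c m)%C by (now field). rewrite Q. ring. }
    pose proof (Carg_polar _ Q) as HQ.
    replace (Carg (c n / c m)) with 0 in HQ.
    2:{ destruct (Req_dec (Carg (c n / c m)) 0) as [Z|Z]; [easy|].
        now destruct (Rabs_no_R0 _ Z (H n m Hn Hm E Hc)). }
    replace (cis 0) with (RtoC 1) in HQ by (unfold cis; now rewrite cos_0, sin_0).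
    rewrite Cmult_1_r, Cmod_div in HQ by easy.
    assert (En : c n = (Cmod (c n) * cis ga)%C).
    { assert (Hm0 : Cmod (c m) <> 0) by (intros Z; now apply Hc, Cmod_eq_0).
      transitivity (RtoC (Cmod (c n) / Cmod (c m)) * c m)%C.
      { rewrite <- HQ. now field. }
      transitivity (RtoC (Cmod (c n) / Cmod (c m)) * (Cmod (c m) * cis ga))%C.
      { now rewrite <- Hga. }
      rewrite Cmult_assoc, <- RtoC_mult. do 2 f_equal. now field. }
    rewrite En at 1. rewrite Re_cis_scal, Rplus_opp_r, cos_0. ring.
  - exists 0. intros n Hn. assert (E : c n = 0%C).
    { apply NNPP. intros E. apply Hno. now exists n. }
    rewrite E, Cmod_0. unfold Re, Cmult; simpl. ring.
Qed.

Lemma sum_n_m_nonneg (f : nat -> R) (p : nat) :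
  (forall k, (1 <= k <= p)%nat -> 0 <= f k) -> 0 <= sum_n_m f 1 p.
Proof.
  induction p as [|p IH]; intros Hf.
  - rewrite sum_n_m_zero by lia. apply Rle_refl.
  - rewrite sum_n_Sm by lia. apply Rplus_le_le_0_compat; [|apply Hf; lia].
    apply IH. intros k Hk; apply Hf; lia.
Qed.

Lemma sum_n_m_ge_term (f : nat -> R) (p n : nat) :
  (forall k, (1 <= k <= p)%nat -> 0 <= f k) -> (1 <= n <= p)%nat -> f n <= sum_n_m f 1 p.
Proof.
  induction p as [|p IH]; intros Hf Hn; [lia|].
  rewrite sum_n_Sm by lia. change (f n <= sum_n_m f 1 p + f (S p)).
  destruct (Nat.eq_dec n (S p)) as [->|Hne].
  - assert (0 <= sum_n_m f 1 p); [|lra].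
    apply sum_n_m_nonneg. intros k Hk; apply Hf; lia.
  - assert (f n <= sum_n_m f 1 p) by (apply IH; [intros k Hk; apply Hf; lia|lia]).
    assert (0 <= f (S p)) by (apply Hf; lia). lra.
Qed.

Lemma Cmod_reverse_triangle (z w : C) : Rabs (Cmod z - Cmod w) <= Cmod (z - w).
Proof.
  pose proof (Cmod_triangle (z - w) w) as H1.
  pose proof (Cmod_triangle (w - z) z) as H2.
  replace (z - w + w)%C with z in H1 by ring.
  replace (w - z + z)%C with w in H2 by ring.
  replace (w - z)%C with (- (z - w))%C in H2 by ring. rewrite Cmod_opp in H2.
  apply Rabs_le. lra.
Qed.

(** Here quasiregularity enters; multiplying [F_zbar] by a unimodular factor
    does not change its modulus, so [| |F_z| - |F_zbar| |] is below the
    integrand of the length. *)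
Lemma lambda_integral_le (K : R) (F : C -> C) (r : R)
  (hK : 1 <= K) (hqr : quasiregular K F) (HF : smooth_on 1 unit_disk F) (hr : 0 < r < 1) :
  r * RInt (fun t => Cmod (Dz F (r * cis t))) 0 (2 * PI)
    + r * RInt (fun t => Cmod (Dzbar F (r * cis t))) 0 (2 * PI) <= K * length_at F r.
Proof.
  assert (Cz := fun t => continuous_on_circle (Dz F) r t hr
    (fun z => continuous_Dz F z HF)).
  assert (Cw := fun t => continuous_on_circle (Dzbar F) r t hr
    (fun z => continuous_Dzbar F z HF)).
  assert (E1 := ex_RInt_Cmod _ 0 (2 * PI) Cz).
  assert (E2 := ex_RInt_Cmod _ 0 (2 * PI) Cw).
  assert (E3 : ex_RInt (fun t => Cmod (Dz F (r * cis t) - cis (- 2 * t) * Dzbar F (r * cis t))%C)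
     0 (2 * PI)).
  { apply ex_RInt_Cmod. intros t. apply continuous_Cminus; [apply Cz|].
    apply continuous_Cmult; [|apply Cw]. apply continuous_cis.
    apply (continuous_scal_r (V := R_NormedModule) (-2)), continuous_id. }
  unfold length_at.
  rewrite <- Rmult_plus_distr_l.
  replace (K * (r * RInt (fun t => Cmod (Dz F (r * cis t) - cis (- 2 * t) * Dzbar F (r * cis t))%C)
     0 (2 * PI))) with
    (r * (K * RInt (fun t => Cmod (Dz F (r * cis t) - cis (- 2 * t) * Dzbar F (r * cis t))%C)
     0 (2 * PI))) by ring.
  apply Rmult_le_compat_l; [lra|].
  refine (is_RInt_le _ _ 0 (2 * PI) _ _ _
    (is_RInt_plus (V := R_NormedModule) _ _ _ _ _ _
      (RInt_correct (V := R_CompleteNormedModule) _ _ _ E1)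
      (RInt_correct (V := R_CompleteNormedModule) _ _ _ E2))
    (is_RInt_scal (V := R_NormedModule) _ _ _ K _
      (RInt_correct (V := R_CompleteNormedModule) _ _ _ E3)) _).
  - pose proof PI_RGT_0; lra.
  - intros t _. eapply Rle_trans; [exact (hqr _ (polar_in_disk r t hr))|].
    apply Rmult_le_compat_l; [lra|]. unfold lambda_min.
    replace (Cmod (Dzbar F (r * cis t))) with (Cmod (cis (- 2 * t) * Dzbar F (r * cis t))%C)
      by (rewrite Cmod_mult, Cmod_cis; ring).
    apply Cmod_reverse_triangle.
Qed.

Lemma length_at_le_one (F : C -> C) (r : R) :
  Rbar_lt (length_one F) p_infty -> 0 < r < 1 -> length_at F r <= real (length_one F).
Proof.
  intros Hfin Hr.
  assert (H : Rbar_le (length_at F r) (length_one F)).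
  { apply (proj1 (Lub_Rbar_correct _)). now exists r. }
  destruct (length_one F); [exact H|easy|easy].
Qed.

(** The passage [r -> 1]. *)
Lemma pow_le_limit (c d : R) (m : nat) :
  (forall r, 0 < r < 1 -> c * r ^ m <= d) -> c <= d.
Proof.
  intros H. destruct (Rle_dec c d) as [|Hn]; [easy|exfalso].
  assert (Hc : continuous (T := R_UniformSpace) (U := R_UniformSpace) (fun r => c * r ^ m) 1).
  { apply (ex_derive_continuous (K := R_AbsRing) (V := R_NormedModule)). auto_derive; easy. }
  destruct (Hc (fun u => d < u)) as [e He].
  { apply open_gt. rewrite pow1. lra. }
  pose proof (cond_pos e) as He0.
  set (x := Rmin (e / 2) (1 / 2)).
  assert (Hx : 0 < x <= 1 / 2 /\ x < e).
  { unfold x. pose proof (Rmin_l (e / 2) (1 / 2)). pose proof (Rmin_r (e / 2) (1 / 2)).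
    assert (0 < Rmin (e / 2) (1 / 2)) by (apply Rmin_pos; lra). lra. }
  assert (B : d < c * (1 - x) ^ m).
  { apply He. change (Rabs ((1 - x) - 1) < e).
    replace ((1 - x) - 1) with (- x) by ring. rewrite Rabs_Ropp, Rabs_pos_eq; lra. }
  specialize (H (1 - x)). lra.
Qed.

Theorem theorem2 (p : nat) (K : R) (F : C -> C) (h g : nat -> C -> C)
  (a b : nat -> nat -> C)
  (hp : (1 <= p)%nat) (hK : 1 <= K)
  (hqr : quasiregular K F)
  (hpoly : polyharmonic p unit_disk F)
  (hh : forall (n : nat) (z : C), (1 <= n <= p)%nat -> unit_disk z ->
     is_series (V := C_NormedModule) (fun k : nat => (a n (S k) * z ^ (S k))%C) (h n z))
  (hg : forall (n : nat) (z : C), (1 <= n <= p)%nat -> unit_disk z ->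
     is_series (V := C_NormedModule) (fun k : nat => (b n (S k) * z ^ (S k))%C) (g n z))
  (hF : forall z : C, unit_disk z ->
     F z = sum_n_m (G := C_AbelianMonoid)
             (fun n : nat => (RtoC (Cmod z ^ (2 * (n - 1))) * (h n z + Cconj (g n z)))%C)
             1 p)
  (hlen : Rbar_lt (length_one F) p_infty)
  (harg_a : forall j n1 n2 : nat, (1 <= j)%nat -> (1 <= n1 <= p)%nat -> (1 <= n2 <= p)%nat ->
     a n1 j <> 0%C -> a n2 j <> 0%C -> Rabs (Carg (a n1 j / a n2 j)%C) = 0)
  (harg_b : forall j n1 n2 : nat, (1 <= j)%nat -> (1 <= n1 <= p)%nat -> (1 <= n2 <= p)%nat ->
     b n1 j <> 0%C -> b n2 j <> 0%C -> Rabs (Carg (b n1 j / b n2 j)%C) = 0) :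
  forall n j : nat, (1 <= n <= p)%nat -> (1 <= j)%nat ->
    Cmod (a n j) + Cmod (b n j)
      <= K * real (length_one F) / (2 * PI * (INR n + INR j - 1)).
Proof.
  intros n j Hn Hj.
  assert (HF : smooth_on 1 unit_disk F).
  { apply smooth_on_le with (2 * p)%nat; [apply open_unit_disk|lia|apply hpoly]. }
  destruct (common_phase p (fun n => a n j)) as [ga Hga].
  { intros n1 n2; now apply harg_a. }
  destruct (common_phase p (fun n => b n j)) as [gb Hgb].
  { intros n1 n2; now apply harg_b. }
  assert (term : forall (c : nat -> nat -> C) (th r : R), 0 < r < 1 ->
    (forall k, (1 <= k <= p)%nat -> Re (cis (- th) * c k j)%C = Cmod (c k j)) ->
    2 * PI * (INR n + INR j - 1) * Cmod (c n j) * r ^ (2 * (n - 1) + j) <=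
    sum_n_m (fun k => 2 * PI * INR (k - 1 + j) * Re (cis (- th) * c k j)%C
                      * r ^ (2 * (k - 1) + j)) 1 p).
  { intros c th r Hr Hth.
    replace (INR n + INR j - 1) with (INR (n - 1 + j)).
    2:{ rewrite plus_INR, minus_INR by lia. simpl. ring. }
    rewrite <- (Hth n Hn).
    apply (sum_n_m_ge_term (fun k => 2 * PI * INR (k - 1 + j) * Re (cis (- th) * c k j)%C
                      * r ^ (2 * (k - 1) + j)) p n); [|exact Hn].
    intros k Hk. rewrite (Hth k Hk).
    pose proof PI_RGT_0. pose proof (pos_INR (k - 1 + j)). pose proof (Cmod_ge_0 (c k j)).
    assert (0 <= r ^ (2 * (k - 1) + j)) by (apply pow_le; lra).
    apply Rmult_le_pos; [apply Rmult_le_pos; [apply Rmult_le_pos|]|]; try assumption.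
    lra. }
  assert (bound : 2 * PI * (INR n + INR j - 1) * (Cmod (a n j) + Cmod (b n j))
                  <= K * real (length_one F)).
  { apply pow_le_limit with (2 * (n - 1) + j)%nat. intros r Hr.
    pose proof (term a ga r Hr Hga) as Ta.
    pose proof (term b gb r Hr Hgb) as Tb.
    pose proof (coefficient_sum_le p F h g a b HF hh hg hF j r ga Hj Hr) as Sa.
    pose proof (coefficient_sum_le p (conj_map F) g h b a (smooth1_conj_map _ _ HF) hg hh
      (conj_map_expansion p F h g hF) j r gb Hj Hr) as Sb.
    rewrite (RInt_ext _ (fun t => Cmod (Dzbar F (r * cis t)))) in Sb
      by (intros t _; now rewrite Dz_conj_map, Cmod_conj).
    pose proof (lambda_integral_le K F r hK hqr HF Hr) as L.
    pose proof (length_at_le_one F r hlen Hr) as L1.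
    apply (Rmult_le_compat_l K) in L1; [|lra].
    lra. }
  assert (Hpos : 0 < 2 * PI * (INR n + INR j - 1)).
  { pose proof PI_RGT_0. pose proof (le_INR 1 n (proj1 Hn)). pose proof (le_INR 1 j Hj).
    simpl in *. nra. }
  apply Rle_div_r; lra.
Qed.
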